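(* Let $X,X_1,X_2,\ldots,X_n$ be independent and identically distributed mean zero, variance one random variables with vanishing third moment $EX^3=0$ and $EX^4$ finite. Set $W=\sum_{i=1}^nX_i$. Then for any function $h:\mathbb{R}\to\mathbb{R}$ with four bounded derivatives, $$|E\{h(W/\sqrt{n})-\Phi h\}|\le n^{-1}\left\{\frac13\|h^{(3)}\|+\frac16\|h^{(4)}\|\,EX^4\right\}.$$
   Context: $\Phi h=Eh(Z)$ with $Z\sim\mathcal{N}(0,1)$; $\|\cdot\|$ is the supremum norm; $h$ has four bounded derivatives if $h$ is four times differentiable and $h^{(1)},\ldots,h^{(4)}$ are bounded. *)

(* Defs.v *)
From HB Require Import structures.
From mathcomp Require Import all_boot all_order all_algebra.
From mathcomp Require Import all_classical all_reals all_analysis.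

Set Implicit Arguments.
Unset Strict Implicit.
Unset Printing Implicit Defensive.

Import Order.TTheory GRing.Theory Num.Theory.
Import numFieldNormedType.Exports.

Local Open Scope classical_set_scope.
Local Open Scope ring_scope.

(* Mutual independence: the product rule over every finite subfamily; for a
   finite index type every subfamily is given by some J : {set I}. *)
Definition independent_RVs (d : measure_display) (T : measurableType d)
    (R : realType) (P : probability T R) (I : finType)
    (X : I -> {RV P >-> R}) : Prop :=
  forall (J : {set I}) (A : I -> set R),
    (forall i, measurable (A i)) ->
    P (\bigcap_(i in [set` J]) (X i @^-1` A i)) =
    (\prod_(i in J) P (X i @^-1` A i))%E.

Definition identically_distributed (d : measure_display) (T : measurableType d)
    (R : realType) (P : probability T R) (I : finType)
    (X : I -> {RV P >-> R}) : Prop :=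
  forall (i j : I) (A : set R), measurable A ->
    distribution P (X i) A = distribution P (X j) A.

Definition iid (d : measure_display) (T : measurableType d)
    (R : realType) (P : probability T R) (I : finType)
    (X : I -> {RV P >-> R}) : Prop :=
  independent_RVs X /\ identically_distributed X.

(* E h(Z) for Z with the standard normal law. *)
Definition Phi (R : realType) (h : R -> R) : \bar R :=
  ('E_(normal_prob 0 1)[h])%E.

(* Extended-real valued, so that it is the true supremum even when f is
   unbounded. *)
Definition sup_norm (R : realType) (f : R -> R) : \bar R :=
  ereal_sup (range (fun x => `|f x|%:E)).

Definition has_bounded_derivatives (R : realType) (m : nat) (h : R -> R) : Prop :=
  (forall (k : nat) (x : R), (k < m)%N -> derivable (h^`(k))%classic x 1) /\
  (forall k : nat, (0 < k <= m)%N -> [bounded (h^`(k))%classic x | x in [set: R]]).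

(* Main.v *)
Require Import Defs.
From HB Require Import structures.
From mathcomp Require Import all_boot all_order all_algebra.
From mathcomp Require Import all_classical all_reals all_analysis.
From mathcomp Require Import measurable_realfun.
From mathcomp Require Import ring lra.

Set Implicit Arguments.
Unset Strict Implicit.
Unset Printing Implicit Defensive.

Import Order.TTheory GRing.Theory Num.Theory.
Import numFieldNormedType.Exports.

Local Open Scope classical_set_scope.
Local Open Scope ring_scope.

(** The proof is the exchange argument of Lindeberg, carried out with
operators on Lipschitz functions instead of random variables on a common
space.  For a random variable U write A_U f (x) = E f (x + U).  Put
g (x) = h (x / sqrt n).

Independence gives E h (W / sqrt n) = (A_X ^ n g) (0)
([expectation_block_sum]).  The Gaussian law is stable under sums of
independent copies, so that A_Z ^ n g (0) = E g (sqrt n Z) = E h (Z)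
([iter_gauss_avg]).  The operators A_X and A_Z commute, by Fubini, and neither
increases the sup distance of two functions, whence the n-th powers applied to
g differ by at most n times the sup distance of A_X g and A_Z g
([iter_mean_shift_swap]).

For a single step, expand h to third order around x / sqrt n
([taylor4]).  The laws of X and Z share their moments 0, 1, 0 of orders 1, 2, 3,
so the polynomial parts have the same mean, and the remainders add up to at
most |h^(4)| (E X^4 + E Z^4) / (24 n^2), where E Z^4 = 3
([mean_shift_second_order], [gauss_moment4]).  Multiplying by n yields
|h^(4)| (E X^4 + 3) / (24 n), and E X^4 >= (E X^2)^2 = 1 turns this into
|h^(4)| E X^4 / (6 n). *)

(** * Averaging Lipschitz functions over a random shift *)

Definition lipschitz_with (R : realType) (L : R) (f : R -> R) :=
  forall x y, `|f x - f y| <= L * `|x - y|.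

Lemma lipschitz_continuous (R : realType) (L : R) (f : R -> R) :
  lipschitz_with L f -> continuous f.
Proof.
move=> fL x; apply/cvgrPdist_le => e e0.
near=> y.
apply: (le_trans (fL _ _)).
have L1 : 0 < `|L| + 1 by rewrite ltr_wpDl.
apply: (@le_trans _ _ ((`|L| + 1) * `|x - y|)).
  by rewrite ler_wpM2r// (le_trans (ler_norm _))// lerDl.
rewrite mulrC -ler_pdivlMr//; near: y.
by apply: cvgr_dist_le; [exact: cvg_id|rewrite divr_gt0].
Unshelve. all: by end_near. Qed.

Lemma lipschitz_measurable (R : realType) (L : R) (f : R -> R) :
  lipschitz_with L f -> measurable_fun setT f.
Proof. by move=> /lipschitz_continuous; exact: continuous_measurable_fun. Qed.

Lemma lipschitz_integrable d (T : measurableType d) (R : realType)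
    (P : probability T R) (L : R) (f : R -> R) (U : T -> R) :
  lipschitz_with L f -> measurable_fun setT U ->
  P.-integrable setT (EFin \o U) -> P.-integrable setT (EFin \o (f \o U)).
Proof.
move=> fL mU iU.
have mf := lipschitz_measurable fL.
apply: (@le_integrable _ _ _ P _ measurableT _ (fun t => (`|f 0| + L * `|U t|)%:E)).
- by apply/measurable_EFinP; exact: measurableT_comp.
- move=> t _ /=; rewrite lee_fin.
  have := fL (U t) 0; rewrite subr0 => h.
  rewrite [leRHS]ger0_norm.
    by have := ler_distD 0 (f (U t)) (f 0); have := ler_normD (f (U t) - f 0) (f 0); rewrite subrK; lra.
  by have := normr_ge0 (f (U t) - f 0); have := normr_ge0 (f 0); lra.
- apply: (@eq_integrable _ _ _ P _ measurableT ((fun=> (`|f 0|)%:E) \+ (fun t => L%:E * (`|U t|)%:E)%E)) => //.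
  apply: integrableD => //.
    exact: finite_measure_integrable_cst.
  apply: integrableZl => //.
  exact: (integrable_norm iU).
Qed.

Lemma integral_cst_probability d (T : measurableType d) (R : realType)
    (P : probability T R) (c : \bar R) : (\int[P]_t c = c)%E.
Proof. by rewrite (integral_cst P measurableT c)/= probability_setT mule1. Qed.

(** Convolution with the law of - U, an operator on functions.  Keeping U on its own
probability space lets variables living on different spaces be composed. *)
Definition mean_shift d (T : measurableType d) (R : realType)
    (P : probability T R) (U : T -> R) (f : R -> R) : R -> R :=
  fun x => (\int[P]_t f (x + U t))%R.

Lemma lipschitz_shift (R : realType) (L x : R) (f : R -> R) :
  lipschitz_with L f -> lipschitz_with L (fun y => f (x + y)).
Proof. by move=> fL y z; rewrite (le_trans (fL _ _))// opprD addrACA subrr add0r. Qed.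

Section mean_shift.
Context d (T : measurableType d) (R : realType) (P : probability T R).
Variable U : T -> R.
Hypothesis iU : P.-integrable setT (EFin \o U).

Let mU : measurable_fun setT U.
Proof. by apply/measurable_EFinP; exact: measurable_int iU. Qed.

Lemma mean_shift_integrable (L x : R) (f : R -> R) :
  lipschitz_with L f -> P.-integrable setT (fun t => (f (x + U t))%:E).
Proof.
move=> fL.
exact: (lipschitz_integrable (lipschitz_shift x fL) mU iU).
Qed.

Lemma Rintegral_le_cst (C : R) (g : T -> R) :
  P.-integrable setT (EFin \o g) -> (forall t, `|g t| <= C) ->
  `| (\int[P]_t g t)%R | <= C.
Proof.
move=> ig gC.
apply: (le_trans (le_normr_Rintegral measurableT ig)).
have -> : C = (\int[P]_t C)%R.
  by rewrite Rintegral_cst//= probability_setT mulr1.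
apply: le_Rintegral => //.
  exact: (integrable_norm ig).
exact: finite_measure_integrable_cst.
Qed.

Lemma mean_shift_close (L C : R) (f g : R -> R) :
  lipschitz_with L f -> lipschitz_with L g -> (forall x, `|f x - g x| <= C) ->
  forall x, `|mean_shift P U f x - mean_shift P U g x| <= C.
Proof.
move=> fL gL fgC x; rewrite /mean_shift -RintegralB//; try exact: mean_shift_integrable.
apply: Rintegral_le_cst => [|t]; last exact: fgC.
exact: (integrableB measurableT (mean_shift_integrable _ fL) (mean_shift_integrable _ gL)).
Qed.

Lemma lipschitz_mean_shift (L : R) (f : R -> R) :
  lipschitz_with L f -> lipschitz_with L (mean_shift P U f).
Proof.
move=> fL x y; rewrite /mean_shift -RintegralB//; try exact: mean_shift_integrable.
apply: Rintegral_le_cst => [|t].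
  exact: (integrableB measurableT (mean_shift_integrable _ fL) (mean_shift_integrable _ fL)).
by rewrite (le_trans (fL _ _))// opprD addrACA subrr addr0.
Qed.

End mean_shift.

(** Both sides are the mean of f (x + U1 + U2) over the product space.  The
Lipschitz bound makes that function integrable, hence Fubini applies. *)
Lemma mean_shiftC d1 (T1 : measurableType d1) d2 (T2 : measurableType d2)
    (R : realType) (P1 : probability T1 R) (P2 : probability T2 R)
    (U1 : T1 -> R) (U2 : T2 -> R) (L : R) (f : R -> R) :
  P1.-integrable setT (EFin \o U1) -> P2.-integrable setT (EFin \o U2) ->
  lipschitz_with L f ->
  mean_shift P1 U1 (mean_shift P2 U2 f) = mean_shift P2 U2 (mean_shift P1 U1 f).
Proof.
move=> iU1 iU2 fL; apply/funext => x; rewrite /mean_shift.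
have mU1 : measurable_fun setT U1 by apply/measurable_EFinP; exact: measurable_int iU1.
have mU2 : measurable_fun setT U2 by apply/measurable_EFinP; exact: measurable_int iU2.
have i12 : (P1 \x P2)%E.-integrable setT (fun z => (f (x + U1 z.1 + U2 z.2))%:E).
  have -> : (fun z => (f (x + U1 z.1 + U2 z.2))%:E) =
      EFin \o ((fun y => f (x + y)) \o (fun z => U1 z.1 + U2 z.2)).
    by apply/funext => z /=; rewrite addrA.
  apply: (lipschitz_integrable (lipschitz_shift x fL)).
    by apply: measurable_funD; apply: measurableT_comp.
  apply: (@eq_integrable _ _ _ _ _ measurableT ((fun z => (U1 z.1)%:E) \+ (fun z => (U2 z.2)%:E))%E) => //.
  apply: integrableD => //.
    apply/integrable12ltyP; first by do 2 apply: measurableT_comp => //.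
    under eq_integral => a _.
      rewrite (_ : \int[P2]_y _ = `|(U1 a)%:E|)%E; last first.
        exact: (integral_cst_probability P2 `|(U1 a)%:E|%E).
      over.
    by case/integrableP: iU1.
  apply/integrable21ltyP; first by do 2 apply: measurableT_comp => //.
  under eq_integral => a _.
    rewrite (_ : \int[P1]_y _ = `|(U2 a)%:E|)%E; last first.
      exact: (integral_cst_probability P1 `|(U2 a)%:E|%E).
    over.
  by case/integrableP: iU2.
have := Fubini i12.
rewrite /Rintegral => h.
congr fine.
transitivity (\int[P1]_t1 (\int[P2]_t2 (f (x + U1 t1 + U2 t2))%:E))%E.
  apply: eq_integral => t1 _; rewrite fineK//.
  exact: (integrable_fin_num measurableT (mean_shift_integrable iU2 _ fL)).
rewrite h; apply: eq_integral => t2 _ /=; rewrite fineK//.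
  by apply: eq_integral => t1 _; rewrite addrAC.
exact: (integrable_fin_num measurableT (mean_shift_integrable iU1 _ fL)).
Qed.

Section iterated_mean_shift.
Context d1 (T1 : measurableType d1) d2 (T2 : measurableType d2)
  (R : realType) (P1 : probability T1 R) (P2 : probability T2 R).
Variables (U1 : T1 -> R) (U2 : T2 -> R) (L C : R).
Hypothesis iU1 : P1.-integrable setT (EFin \o U1).
Hypothesis iU2 : P2.-integrable setT (EFin \o U2).
Let A1 := mean_shift P1 U1.
Let A2 := mean_shift P2 U2.

Lemma lipschitz_iter_mean_shift k (f : R -> R) :
  lipschitz_with L f -> lipschitz_with L (iter k A1 f).
Proof. by move=> fL; elim: k => //= k IH; exact: lipschitz_mean_shift. Qed.

Lemma iter_mean_shift_close k (f g : R -> R) :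
  lipschitz_with L f -> lipschitz_with L g -> (forall x, `|f x - g x| <= C) ->
  forall x, `|iter k A1 f x - iter k A1 g x| <= C.
Proof.
move=> fL gL fg; elim: k => //= k IH.
exact: (mean_shift_close iU1 (lipschitz_iter_mean_shift k fL)
                             (lipschitz_iter_mean_shift k gL)).
Qed.

(** Telescoping: writing A1^(k+1) f - A2^(k+1) f as
A1^k (A1 f - A2 f) + (A1^k - A2^k) (A2 f), the first term is controlled by
contraction and the second by induction, since commutation transports the
one-step bound from f to A2 f. *)
Lemma iter_mean_shift_swap k (f : R -> R) :
  lipschitz_with L f -> (forall x, `|A1 f x - A2 f x| <= C) ->
  forall x, `|iter k A1 f x - iter k A2 f x| <= k%:R * C.
Proof.
elim: k f => [|k IH] f fL fC x; first by rewrite subrr normr0 mul0r.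
rewrite !iterSr.
have A1L : lipschitz_with L (A1 f) by exact: lipschitz_mean_shift.
have A2L : lipschitz_with L (A2 f) by exact: lipschitz_mean_shift.
apply: (le_trans (ler_distD (iter k A1 (A2 f) x) _ _)).
rewrite -natr1 mulrDl mul1r addrC lerD//.
  apply: IH => // y.
  by rewrite /A1 /A2 (mean_shiftC iU1 iU2 fL); exact: (mean_shift_close iU2).
exact: iter_mean_shift_close.
Qed.

End iterated_mean_shift.

(** * Sums of independent random variables *)

Section joint_law.
Context d (T : measurableType d) (R : realType) (P : probability T R).

(** Given C, the pair (U, V) has the product law as soon as it does on rectangles.
The event C records the values of further variables; this generality is what
allows sums to be built up one summand at a time without losing their
independence of the remaining variables. *)
Lemma joint_law_given (U V : {mfun T >-> R}) (C : set T) :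
  measurable C ->
  (forall A B, measurable A -> measurable B ->
    P (U @^-1` A `&` V @^-1` B `&` C) =
    (P (U @^-1` A) * P (V @^-1` B) * P C)%E) ->
  forall E, measurable E ->
    P ((fun t => (U t, V t)) @^-1` E `&` C) =
    ((distribution P U \x distribution P V) E * P C)%E.
Proof.
move=> mC UVC E mE.
have mUV : measurable_fun setT (fun t => (U t, V t)) by exact/measurable_fun_pair.
have mUVE : measurable ((fun t => (U t, V t)) @^-1` E).
  by rewrite -[X in measurable X]setTI; exact: mUV.
have PCfin : P C \is a fin_num by exact: fin_num_measure.
(* conditioning on C needs P C != 0; otherwise both sides vanish *)
have [PC0|PC0] := eqVneq (P C) 0%E.
  rewrite PC0 mule0; apply/eqP; rewrite eq_le measure_ge0 andbT -PC0.
  by apply: le_measure; rewrite ?inE//; exact: measurableI.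
have PCpos : (0 < fine (P C))%R by rewrite fine_gt0// lt0e PC0 measure_ge0 ltey_eq PCfin.
have invC0 : 0 <= (fine (P C))^-1 by rewrite invr_ge0 ltW.
pose m : {measure set T -> \bar R} := mscale (NngNum invC0) (mrestr P mC).
have mE' X : m X = ((fine (P C))^-1%:E * P (X `&` C))%E by [].
rewrite (product_measure_unique (m' := pushforward m (fun t => (U t, V t))))//.
  by rewrite /= /pushforward mE' -[X in (_ * X)%E](fineK PCfin) muleAC -EFinM mulVf ?mul1e// gt_eqF.
move=> A B mA mB; rewrite /= /pushforward mE'.
rewrite (_ : _ @^-1` (A `*` B) = U @^-1` A `&` V @^-1` B)//.
by rewrite UVC// -[X in (_ * (_ * X))%E](fineK PCfin) muleC -muleA -EFinM divff ?mule1// gt_eqF.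
Qed.

Definition independent2 (U V : T -> R) := forall A B, measurable A -> measurable B ->
    P (U @^-1` A `&` V @^-1` B) = (P (U @^-1` A) * P (V @^-1` B))%E.

Lemma joint_law (U V : {mfun T >-> R}) E : independent2 U V -> measurable E ->
    P ((fun t => (U t, V t)) @^-1` E) = (distribution P U \x distribution P V)%E E.
Proof.
move=> UV mE; have := @joint_law_given U V setT measurableT.
move=> /(_ _ _ mE); rewrite setIT probability_setT mule1; apply => A B mA mB.
by rewrite setIT mule1 UV.
Qed.

Lemma mean_shift_indep_sum (U V : {mfun T >-> R}) (L : R) (f : R -> R) :
  independent2 U V -> P.-integrable setT (EFin \o U) -> P.-integrable setT (EFin \o V) ->
  lipschitz_with L f ->
  (\int[P]_t f (U t + V t) = \int[P]_t mean_shift P V f (U t))%R.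
Proof.
move=> UV iU iV fL.
have mUV : measurable_fun setT (fun t => (U t, V t)) by exact/measurable_fun_pair.
have iUV : P.-integrable setT (fun t => (f (U t + V t))%:E).
  apply: (lipschitz_integrable (U := (fun t => U t + V t)) fL).
    exact: measurable_funD.
  exact: (integrableD measurableT iU iV).
pose g (z : R * R) := (f (z.1 + z.2))%:E.
have mf := lipschitz_measurable fL.
have mg : measurable_fun setT g.
  apply/measurable_EFinP; apply: measurableT_comp => //.
  by apply: measurable_funD; [exact: measurable_fst|exact: measurable_snd].
have eqm A : measurable A -> A `<=` setT ->
    pushforward P (fun t => (U t, V t)) A = (distribution P U \x distribution P V)%E A.
  by move=> mA _; rewrite -(joint_law UV mA).
have ig : (distribution P U \x distribution P V)%E.-integrable setT g.
  apply/integrableP; split => //.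
  rewrite -(eq_measure_integral _ eqm).
  rewrite ge0_integral_pushforward//.
    by case/integrableP : iUV.
  exact: measurableT_comp.
congr fine.
transitivity (\int[pushforward P (fun t => (U t, V t))]_z g z)%E.
  by rewrite integral_pushforward.
rewrite (eq_measure_integral _ eqm).
transitivity (\int[distribution P U]_x \int[distribution P V]_y g (x, y))%E.
  exact/esym/(integral12_prod_meas1 ig).
have inner x : (\int[distribution P V]_y g (x, y) = (mean_shift P V f x)%:E)%E.
  rewrite integral_distribution/=.
  - by rewrite fineK//; exact: (integrable_fin_num measurableT (mean_shift_integrable iV _ fL)).
  - apply/measurable_EFinP; apply: measurableT_comp => //=.
    exact: measurable_funD.
  - exact: (mean_shift_integrable iV _ fL).
transitivity (\int[distribution P U]_x (mean_shift P V f x)%:E)%E.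
  by apply: eq_integral => x _; exact: inner.
rewrite integral_distribution//=.
  apply/measurable_EFinP.
  exact: lipschitz_measurable (lipschitz_mean_shift iV fL).
exact: (lipschitz_integrable (lipschitz_mean_shift iV fL)).
Unshelve. all: by [].
Qed.

End joint_law.

Section block_independence.
Context d (T : measurableType d) (R : realType) (P : probability T R)
  (I : finType) (X : I -> {RV P >-> R}).
Hypothesis indX : independent_RVs X.

Lemma bigcap_setU1_preimage (i : I) (K : {set I}) (A : I -> set R) (B : set R) :
  i \notin K ->
  \bigcap_(j in [set` i |: K]) (X j @^-1` (if j == i then B else A j)) =
  X i @^-1` B `&` \bigcap_(j in [set` K]) (X j @^-1` A j).
Proof.
move=> iK; apply/seteqP; split => [t h|t [h1 h2] j].
  split; first by have := h i (setU11 i K); rewrite /= eqxx.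
  move=> j /= jK; have /= := h j (setU1r i jK).
  by case: eqP => // ji; rewrite -ji jK in iK.
rewrite /= !inE; case: eqP => [-> //|_ /= jK]; exact: h2.
Qed.

Lemma measurable_bigcap_preimage (K : {set I}) (A : I -> set R) :
  (forall i, measurable (A i)) ->
  measurable (\bigcap_(j in [set` K]) (X j @^-1` A j)).
Proof.
move=> mA; apply: fin_bigcap_measurable; first exact: finite_finset.
by move=> j _; exact: measurable_funPTI.
Qed.

Lemma independent_RVsU1 (i : I) (K : {set I}) (A : I -> set R) (B : set R) :
  i \notin K -> (forall j, measurable (A j)) -> measurable B ->
  P (X i @^-1` B `&` \bigcap_(j in [set` K]) (X j @^-1` A j)) =
  (P (X i @^-1` B) * P (\bigcap_(j in [set` K]) (X j @^-1` A j)))%E.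
Proof.
move=> iK mA mB; rewrite -bigcap_setU1_preimage// indX; last first.
  by move=> j; case: eqP.
rewrite big_setU1//= eqxx (indX K mA); congr (_ * _)%E.
by apply: eq_bigr => j jK; case: eqP => // ji; rewrite -ji jK in iK.
Qed.

Definition block_sum (J : {set I}) : {mfun T >-> R} := \sum_(i in J) (X i : {mfun T >-> R}).

Lemma block_sumU1 (i : I) (J : {set I}) : i \notin J ->
  block_sum (i |: J) = (fun t => block_sum J t + X i t) :> (T -> R).
Proof.
by move=> iJ; apply/funext => t; rewrite /block_sum big_setU1//= addrC.
Qed.

Lemma block_sumE J t : block_sum J t = \sum_(i in J) X i t.
Proof.
by rewrite /block_sum; elim/big_rec2 : _ => [//|i a b _ <-].
Qed.

(** Induction on J.  When i is moved out of J, the rectangle condition of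
[joint_law_given] is the induction hypothesis with i added to the block K. *)
Lemma block_sum_indep (J K : {set I}) (A : I -> set R) (B : set R) :
  [disjoint J & K]%B -> (forall j, measurable (A j)) -> measurable B ->
  P (block_sum J @^-1` B `&` \bigcap_(j in [set` K]) (X j @^-1` A j)) =
  (P (block_sum J @^-1` B) * P (\bigcap_(j in [set` K]) (X j @^-1` A j)))%E.
Proof.
have [m] := ubnP #|J|; elim: m J K A B => // m IH J K A B Jm JK mA mB.
have [->|[i iJ]] := finset.set_0Vmem J.
  have S0 t : block_sum finset.set0 t = 0 by rewrite /block_sum big_set0.
  have [B0|B0] := pselect (B 0).
    rewrite (_ : _ @^-1` B = setT); last by apply/seteqP; split => // t _ /=; rewrite S0.
    by rewrite setTI probability_setT mul1e.
  rewrite (_ : _ @^-1` B = set0); last by apply/seteqP; split => // t /=; rewrite S0.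
  by rewrite set0I measure0 mul0e.
set J' := J :\ i.
have iJ' : i \notin J' by rewrite !inE eqxx.
have JE : J = i |: J' by rewrite finset.setD1K.
have J'm : (#|J'| < m)%N by move: Jm; rewrite (cardsD1 i J) iJ.
have iK : i \notin K by apply: contraTN iJ => iK; move/disjointFl : JK => /(_ _ iK) ->.
have J'K : [disjoint J' & K]%B by apply: disjointWl JK; exact: subD1set.
pose V := X i : {mfun T >-> R}.
pose E := [set z : R * R | B (z.1 + z.2)].
have mE : measurable E.
  have mD : measurable_fun setT (fun z : R * R => z.1 + z.2).
    by apply: measurable_funD; [exact: measurable_fst|exact: measurable_snd].
  by rewrite -[E]setTI; exact: mD.
have pre : block_sum J @^-1` B = (fun t => (block_sum J' t, V t)) @^-1` E.
  by rewrite JE block_sumU1.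
have rect (K' : {set I}) A' : i \notin K' -> [disjoint J' & K']%B -> (forall j, measurable (A' j)) ->
  forall B1 B2, measurable B1 -> measurable B2 ->
    P (block_sum J' @^-1` B1 `&` V @^-1` B2 `&` \bigcap_(j in [set` K']) (X j @^-1` A' j)) =
    (P (block_sum J' @^-1` B1) * P (V @^-1` B2) * P (\bigcap_(j in [set` K']) (X j @^-1` A' j)))%E.
  move=> iK' J'K' mA' B1 B2 mB1 mB2.
  rewrite /V -setIA -(bigcap_setU1_preimage A' B2 iK') IH//.
  - by rewrite bigcap_setU1_preimage// independent_RVsU1// muleA.
  - rewrite disjoint_subset; apply/fintype.subsetP => x xJ'.
    rewrite !inE negb_or (disjointFr J'K' xJ') andbT.
    by apply: contraTneq xJ' => ->.
  - by move=> j; case: eqP.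
rewrite pre (joint_law_given _ (rect _ _ iK J'K mA))//; last exact: measurable_bigcap_preimage.
have ind2 : independent2 P (block_sum J') V; last first.
  by congr (_ * _)%E; apply/esym; exact: (joint_law ind2 mE).
move=> B1 B2 mB1 mB2.
have i0 : i \notin finset.set0 by rewrite inE.
have d0 : [disjoint J' & finset.set0]%B by rewrite -setI_eq0 finset.setI0.
have := rect finset.set0 A i0 d0 mA _ _ mB1 mB2.
rewrite (_ : \bigcap_(j in [set` finset.set0]) _ = setT); last first.
  by apply/seteqP; split => // t _ j; rewrite /= inE.
by rewrite setIT probability_setT mule1.
Qed.

Lemma block_sum_independent2 (i : I) (J : {set I}) : i \notin J ->
  independent2 P (block_sum J) (X i).
Proof.
move=> iJ B1 B2 mB1 mB2.
have := @block_sum_indep J [set i]%SET (fun=> B2) B1.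
rewrite (_ : \bigcap_(j in [set` [set i]%SET]) _ = X i @^-1` B2).
  by apply => //; rewrite disjoint_sym disjoints1.
apply/seteqP; split => [t|t h j]; last by rewrite /= inE => /eqP ->.
by apply => /=; rewrite inE.
Qed.

Hypothesis idX : identically_distributed X.
Hypothesis iX : forall i, P.-integrable setT (EFin \o X i).

Lemma mean_shift_identically_distributed (i j : I) (L : R) (f : R -> R) :
  lipschitz_with L f ->
  mean_shift P (X i) f = mean_shift P (X j) f.
Proof.
move=> fL; apply/funext => x; congr fine.
have mf : measurable_fun setT (fun y => (f (x + y))%:E).
  apply/measurable_EFinP; exact: lipschitz_measurable (lipschitz_shift x fL).
transitivity (\int[distribution P (X i)]_y (f (x + y))%:E)%E.
  by rewrite integral_distribution//; exact: mean_shift_integrable fL.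
transitivity (\int[distribution P (X j)]_y (f (x + y))%:E)%E.
  by apply: eq_measure_integral => A mA _; exact: idX.
by rewrite integral_distribution//; exact: mean_shift_integrable fL.
Qed.

Lemma block_sum_integrable J : P.-integrable setT (EFin \o block_sum J).
Proof.
apply: (@eq_integrable _ _ _ P _ measurableT (fun t => \sum_(i <- enum J) (X i t)%:E)%E).
  by move=> t _ /=; rewrite block_sumE sumEFin big_enum.
by apply: integrable_sum => // i _; exact: iX.
Qed.

(** Each summand is independent of the sum of the others, so it can be integrated
out first and contributes one factor A_X; i0 only selects a representative of
the common law. *)
Lemma expectation_block_sum (i0 : I) (J : {set I}) (L : R) (f : R -> R) :
  lipschitz_with L f ->
  (\int[P]_t f (block_sum J t))%R = iter #|J| (mean_shift P (X i0)) f 0.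
Proof.
have [m] := ubnP #|J|; elim: m J f => // m IH J f Jm fL.
have [->|[i iJ]] := finset.set_0Vmem J.
  rewrite cards0 /=; transitivity (\int[P]_t (f 0))%R.
    by apply: eq_Rintegral => t _; rewrite /block_sum big_set0.
  by rewrite (Rintegral_cst P measurableT (f 0))/= probability_setT mulr1.
have iJ' : i \notin J :\ i by rewrite !inE eqxx.
rewrite -{1}(finset.setD1K iJ) block_sumU1//.
have ind := block_sum_independent2 iJ'.
rewrite (mean_shift_indep_sum ind (block_sum_integrable _) (iX i) fL).
rewrite (mean_shift_identically_distributed i i0 fL) IH//.
- by rewrite -iterSr [in RHS](cardsD1 i J) iJ.
- by move: Jm; rewrite (cardsD1 i J) iJ.
- exact: lipschitz_mean_shift.
Qed.

End block_independence.

(** * Normal densities and stability of the Gaussian law *)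

Section normal_density_integral.
Context (R : realType).
Local Notation mu := (@lebesgue_measure R).
Import HBNNSimple.

(** Monotone convergence along simple functions, for which the claim is by linearity
the definition of the normal law. *)
Lemma ge0_integral_normal_prob (m s : R) (f : R -> \bar R) :
  measurable_fun setT f -> (forall x, 0 <= f x)%E ->
  (\int[normal_prob m s]_x f x = \int[mu]_x (f x * (normal_pdf m s x)%:E))%E.
Proof.
move=> mf f0.
have mpdf : measurable_fun setT (fun x => (normal_pdf m s x)%:E).
  by apply/measurable_EFinP; exact: measurable_normal_pdf.
have pdf0 x : (0 <= (normal_pdf m s x)%:E)%E by rewrite lee_fin normal_pdf_ge0.
pose f_ := nnsfun_approx (@measurableT _ (measurableTypeR R)) mf.
have fcvg x : (EFin \o f_^~ x) @ \oo --> f x by exact: cvg_nnsfun_approx.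
have fnd x : {homo (fun n => (f_ n x)%:E) : a b / (a <= b)%N >-> (a <= b)%E}.
  by move=> a b ab; rewrite lee_fin; exact/lefP/nd_nnsfun_approx.
have fnE n : (\int[normal_prob m s]_x (f_ n x)%:E =
    \int[mu]_x ((f_ n x)%:E * (normal_pdf m s x)%:E))%E.
  transitivity (\sum_(k \in range (f_ n))
    (k%:E * normal_prob m s (f_ n @^-1` [set k])))%E.
    by rewrite integralT_nnsfun sintegralE.
  transitivity (\int[mu]_x (\sum_(k \in range (f_ n))
      (k * \1_(f_ n @^-1` [set k]) x)%:E * (normal_pdf m s x)%:E))%E; last first.
    apply: eq_integral => x _.
    rewrite [in RHS]fimfunE -fsumEFin// ge0_mule_fsuml//.
    by move=> k; rewrite nnfun_muleindic_ge0.
  rewrite ge0_integral_fsum//=; last 2 first.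
  - move=> k; apply: emeasurable_funM => //; apply/measurable_EFinP.
    exact: measurable_funM.
  - by move=> k x _; rewrite mule_ge0// nnfun_muleindic_ge0.
  apply: eq_fsbigr => k; rewrite inE => -[t _ <-{k}].
  under [RHS]eq_integral do rewrite EFinM -muleA.
  rewrite ge0_integralZl//=; last 3 first.
  - by apply: emeasurable_funM => //; apply/measurable_EFinP.
  - by move=> x _; rewrite mule_ge0// lee_fin.
  - by rewrite lee_fin.
  congr (_ * _)%E; rewrite /normal_prob integral_mkcond.
  apply: eq_integral => x _; rewrite /patch indicE.
  by case: ifPn => _; rewrite ?mul1e ?mul0e.
transitivity (limn (fun n => \int[normal_prob m s]_x (f_ n x)%:E))%E.
  rewrite -monotone_convergence//.
  - by apply: eq_integral => x _; apply/esym/cvg_lim => //; exact: fcvg.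
  - by move=> n; apply/measurable_EFinP.
  - by move=> n x _; rewrite lee_fin.
rewrite (_ : (fun n => _) = fun n => \int[mu]_x ((f_ n x)%:E * (normal_pdf m s x)%:E))%E; last first.
  by apply/funext => n; exact: fnE.
rewrite -monotone_convergence//.
- apply: eq_integral => x _; apply/cvg_lim => //.
  by apply: cvgeZr => //; exact: fcvg.
- by move=> n; apply: emeasurable_funM => //; apply/measurable_EFinP.
- by move=> n x _; rewrite mule_ge0// lee_fin.
- by move=> x _ a b ab; apply: lee_wpmul2r => //; exact: fnd.
Qed.

End normal_density_integral.

Section gauss_rotation.
Context (R : realType).
Local Notation mu := (@lebesgue_measure R).

(** The substitution u = m + s z. *)
Lemma affine_normal_density (m s : R) (G : R -> R) : 0 < s ->
  continuous G -> (forall x, 0 <= G x) ->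
  (\int[mu]_z (G (m + s * z) * normal_pdf 0 1 z)%:E =
   \int[mu]_u (G u * normal_pdf m s u)%:E)%E.
Proof.
move=> s0 cG G0.
have sn0 : s != 0 by rewrite gt_eqF.
have sV0 : 0 < s^-1 by rewrite invr_gt0.
pose F (u : R^o) := (u - m) / s.
pose H (z : R) : R := G (m + s * z) * normal_pdf 0 1 z.
have F'E : F^`()%classic = cst s^-1.
  apply/funext => x; rewrite /F derive1E deriveM// deriveD// derive_cst scaler0.
  by rewrite add0r derive_id derive_cst addr0 scaler1.
rewrite -[LHS]/(\int[mu]_z (H z)%:E)%E.
rewrite (@increasing_ge0_integration_by_substitutionT _ F)//; first last.
- by move=> x; rewrite mulr_ge0// normal_pdf_ge0.
- move=> x; apply: (@continuousM _ _ (fun z => G (m + s * z))).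
    apply: continuous_comp; last exact: cG.
    apply: (@continuousD _ R^o); first exact: cst_continuous.
    by apply: (@continuousM _ _ (cst s) id); [exact: cst_continuous|exact: cvg_id].
  by apply: continuous_normal_pdf; exact: oner_neq0.
- by apply/gt0_cvgMly => //; exact: cvg_addrr.
- by apply/gt0_cvgMlNy => //; exact: cvg_addrr_Ny.
- by rewrite F'E; exact: is_cvg_cst.
- by rewrite F'E; exact: is_cvg_cst.
- by rewrite F'E => ?; exact: cvg_cst.
- by move=> x y xy; rewrite /F ltr_pM2r// ltrD2r.
apply: eq_integral => u _; rewrite F'E !fctE/= /H /F.
congr EFin; rewrite (_ : m + s * ((u - m) / s) = u); last by field.
rewrite -mulrA; congr (_ * _).
rewrite !normal_pdfE ?oner_neq0// /normal_peak /normal_fun mulrAC; congr (_ * expR _).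
  rewrite -!mulrnAr sqrtrM ?sqr_ge0// sqrtr_sqr normr1 mul1r.
  by rewrite sqrtrM ?sqr_ge0// sqrtr_sqr gtr0_norm// invfM mulrC.
rewrite !mulr2n; field.
by rewrite -mulr2n mulrn_eq0 /= expf_eq0/= sn0.
Qed.

(** The joint density of (Y, a Y + b Z) is factored here in the other order: the law
of the sum, N(0, c^2), times the conditional law of Y given that the sum is
u. *)
Lemma normal_pdf_complete_square (a b c u y : R) : 0 < b -> 0 < c ->
  c ^+ 2 = a ^+ 2 + b ^+ 2 ->
  normal_pdf 0 1 y * normal_pdf (a * y) b u =
  normal_pdf 0 c u * normal_pdf (a * u / c ^+ 2) (b / c) y.
Proof.
move=> b0 c0 cE.
have bn0 : b != 0 by rewrite gt_eqF.
have cn0 : c != 0 by rewrite gt_eqF.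
rewrite !normal_pdfE ?oner_neq0 ?mulf_neq0 ?invr_eq0// /normal_peak /normal_fun.
rewrite mulrACA [in RHS]mulrACA -!expRD; congr (_ * expR _).
  have sqrtE (s : R) : 0 < s -> Num.sqrt (s ^+ 2 * pi *+ 2) = s * Num.sqrt (pi *+ 2).
    by move=> s0; rewrite -mulrnAr sqrtrM ?sqr_ge0// sqrtr_sqr gtr0_norm.
  rewrite !sqrtE ?divr_gt0//.
  have : Num.sqrt (@pi R *+ 2) != 0.
    by rewrite gt_eqF// sqrtr_gt0 mulrn_wgt0// pi_gt0.
  move: (Num.sqrt _) => q q0; field.
  by rewrite cn0 q0 bn0.
rewrite !mulr2n.
have -> : - (y - 0) ^+ 2 / (1 ^+ 2 + 1 ^+ 2) + - (u - a * y) ^+ 2 / (b ^+ 2 + b ^+ 2) =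
  - (u - 0) ^+ 2 / (c ^+ 2 + c ^+ 2) +
    - (y - a * u / c ^+ 2) ^+ 2 / ((b / c) ^+ 2 + (b / c) ^+ 2) +
  (c ^+ 2 - (a ^+ 2 + b ^+ 2)) * ((y ^+ 2 - u ^+ 2 / c ^+ 2) / (2 * b ^+ 2)).
  field.
  by rewrite bn0 cn0 -!mulr2n !mulrn_eq0/= !expf_eq0/= bn0 cn0.
by rewrite -cE subrr mul0r addr0.
Qed.

Local Notation gauss := (normal_prob 0 1 : probability (measurableTypeR R) R).

(** If Y and Z are independent standard normal then a Y + b Z has the law of c Z:
after [normal_pdf_complete_square] and Tonelli, the conditional density of Y
integrates to 1. *)
Lemma ge0_gauss_rotation (a b c : R) (G : R -> R) : 0 < b -> 0 < c ->
  c ^+ 2 = a ^+ 2 + b ^+ 2 -> continuous G -> (forall x, 0 <= G x) ->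
  (\int[gauss]_y \int[gauss]_z (G (a * y + b * z))%:E =
   \int[gauss]_z (G (c * z))%:E)%E.
Proof.
move=> b0 c0 cE cG G0.
have mG : measurable_fun setT G by exact: continuous_measurable_fun.
have mpdf m s : measurable_fun setT (normal_pdf m s : measurableTypeR R -> R).
  exact: measurable_normal_pdf.
have shiftE m s x : s != 0 -> normal_pdf m s x = normal_pdf 0 s (x - m).
  by move=> s0; rewrite !normal_pdfE// /normal_fun subr0.
have bn0 : b != 0 by rewrite gt_eqF.
have cn0 : c != 0 by rewrite gt_eqF.
have mGa p q : measurable_fun setT (fun z : measurableTypeR R => (G (p + q * z))%:E).
  apply/measurable_EFinP; apply: measurableT_comp => //.
  by apply: measurable_funD => //; exact: measurable_funM.
have mlin (p q : R) : measurable_fun setT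
    (fun z : measurableTypeR R * measurableTypeR R => p * z.1 + q * z.2).
  by apply: measurable_funD; exact: measurable_funM.
have mG2 : measurable_fun setT
    (fun z : measurableTypeR R * measurableTypeR R => G z.2).
  by apply: measurableT_comp => //; exact: measurable_snd.
have m1 : measurable_fun setT (fun z : measurableTypeR R * measurableTypeR R =>
    (G z.2 * normal_pdf (a * z.1) b z.2)%:E).
  apply/measurable_EFinP; apply: measurable_funM => //.
  rewrite (_ : (fun _ => _) = normal_pdf 0 b \o (fun z => - a * z.1 + 1 * z.2)).
    exact: (measurableT_comp (mpdf 0 b) (mlin (- a) 1)).
  by apply/funext => z /=; rewrite shiftE// mul1r mulNr addrC.
have m2 : measurable_fun setT (fun z : measurableTypeR R * measurableTypeR R =>
    (G z.2 * (normal_pdf 0 c z.2 * normal_pdf (a * z.2 / c ^+ 2) (b / c) z.1))%:E).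
  apply/measurable_EFinP; apply: measurable_funM => //; apply: measurable_funM => //.
    by apply: measurableT_comp => //; exact: measurable_snd.
  rewrite (_ : (fun _ => _) = normal_pdf 0 (b / c) \o (fun z => 1 * z.1 + (- a / c ^+ 2) * z.2)).
    exact: (measurableT_comp (mpdf 0 (b / c)) (mlin 1 (- a / c ^+ 2))).
  apply/funext => z /=; rewrite shiftE ?mulf_neq0 ?invr_eq0// mul1r.
  by congr (normal_pdf _ _ (_ + _)); rewrite -!mulNr mulrAC.
have G0E x : (0 <= (G x)%:E)%E by rewrite lee_fin.
have inner y : (\int[gauss]_z (G (a * y + b * z))%:E =
    \int[mu]_u (G u * normal_pdf (a * y) b u)%:E)%E.
  rewrite (ge0_integral_normal_prob 0 1 (mGa _ _) (fun=> G0E _)).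
  exact: affine_normal_density.
transitivity (\int[gauss]_y \int[mu]_u (G u * normal_pdf (a * y) b u)%:E)%E.
  by apply: eq_integral => y _; exact: inner.
have H0 y : (0 <= \int[mu]_u (G u * normal_pdf (a * y) b u)%:E)%E.
  by apply: integral_ge0 => u _; rewrite lee_fin mulr_ge0// normal_pdf_ge0.
have mH : measurable_fun setT (fun y : measurableTypeR R => \int[mu]_u (G u * normal_pdf (a * y) b u)%:E)%E.
  apply: (measurable_fun_fubini_tonelli_F (m2 := mu) _ m1) => z.
  by rewrite lee_fin mulr_ge0// normal_pdf_ge0.
rewrite (ge0_integral_normal_prob 0 1 mH H0).
transitivity (\int[mu]_y \int[mu]_u
    (G u * (normal_pdf 0 c u * normal_pdf (a * u / c ^+ 2) (b / c) y))%:E)%E.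
  apply: eq_integral => y _.
  rewrite -ge0_integralZr//.
  - apply: eq_integral => u _; rewrite -EFinM; congr EFin.
    by rewrite -(normal_pdf_complete_square u y b0 c0 cE); ring.
  - by apply/measurable_EFinP; exact: measurable_funM.
  - by move=> u _; rewrite lee_fin mulr_ge0// normal_pdf_ge0.
  - by rewrite lee_fin normal_pdf_ge0.
rewrite (fubini_tonelli _ m2); last first.
  by move=> z; rewrite lee_fin !mulr_ge0 ?normal_pdf_ge0.
transitivity (\int[mu]_u (G u * normal_pdf 0 c u)%:E)%E.
  apply: eq_integral => u _ /=.
  transitivity (\int[mu]_y ((G u * normal_pdf 0 c u)%:E *
      (normal_pdf (a * u / c ^+ 2) (b / c) y)%:E))%E.
    by apply: eq_integral => y _; rewrite mulrA EFinM.
  rewrite ge0_integralZl//=.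
  - by rewrite integral_normal_pdf mule1.
  - by apply/measurable_EFinP.
  - by move=> y _; rewrite lee_fin normal_pdf_ge0.
  - by rewrite lee_fin mulr_ge0// normal_pdf_ge0.
rewrite -(affine_normal_density 0 c0 cG G0).
rewrite -(ge0_integral_normal_prob 0 1 (mGa 0 c) (fun=> G0E _)).
by apply: eq_integral => z _; rewrite add0r.
Qed.

End gauss_rotation.

(** * Moments of the standard normal law *)

Section gauss_moments.
Context (R : realType).
Local Notation mu := (@lebesgue_measure R).
Local Notation gauss := (normal_prob 0 1 : probability (measurableTypeR R) R).

Lemma integral_normal_prob (m s : R) (f : R -> R) : measurable_fun setT f ->
  (\int[normal_prob m s]_x (f x)%:E = \int[mu]_x (f x * normal_pdf m s x)%:E)%E.
Proof.
move=> mf; rewrite integralE [RHS]integralE.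
have mfE : measurable_fun setT (EFin \o f : measurableTypeR R -> \bar R).
  exact/measurable_EFinP.
congr (_ - _)%E.
- rewrite ge0_integral_normal_prob//; last exact: measurable_funepos.
  apply: eq_integral => x _; rewrite !funeposE -!EFin_max -EFinM; congr EFin.
  by rewrite maxr_pMl ?normal_pdf_ge0// mul0r.
- rewrite ge0_integral_normal_prob//; last exact: measurable_funeneg.
  apply: eq_integral => x _; rewrite !funenegE -!EFinN -!EFin_max -EFinM; congr EFin.
  by rewrite maxr_pMl ?normal_pdf_ge0// mul0r mulNr.
Qed.

(** On [-n, n] this is the fundamental theorem of calculus; dominated convergence
passes to the whole line. *)
Lemma integral_derive_vanishing (F f : R -> R) :
  continuous f -> mu.-integrable setT (EFin \o f) ->
  (forall x : R, is_derive x (1 : R) F (f x)) ->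
  F n.+1%:R @[n --> \oo] --> (0 : R) -> F (- n.+1%:R) @[n --> \oo] --> (0 : R) ->
  (\int[mu]_x (f x)%:E = 0)%E.
Proof.
move=> cf intf dF Fy FNy.
pose f_ n x := ((f \_ `[- n.+1%:R, n.+1%:R]) x)%:E.
have mf : measurable_fun setT f by exact: continuous_measurable_fun.
have dc := @dominated_convergence _ (measurableTypeR R) R mu setT measurableT
  f_ (EFin \o f) (fun x => `|(f x)%:E|%E).
have cvgf : (\int[mu]_x f_ n x)%E @[n --> \oo] --> (\int[mu]_x (f x)%:E)%E.
  case: dc => // [n||||].
  - apply/measurable_EFinP.
    by apply/(measurable_restrictT _ _).1 => //; exact: measurable_funTS.
  - exact/measurable_EFinP.
  - apply: aeW => x _.
    apply: cvg_near_cst; near=> n.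
    rewrite /f_ patchE mem_set//= in_itv/= -ler_norml.
    apply: (@le_trans _ _ n%:R); last by rewrite ler_nat.
    by near: n; exact: nbhs_infty_ger.
  - exact: integrable_abse.
  - apply: aeW => x n _; rewrite /f_ patchE; case: ifPn => // _.
    by rewrite /= normr0 lee_fin.
have intE n : (\int[mu]_x f_ n x = (F n.+1%:R - F (- n.+1%:R))%:E)%E.
  transitivity (\int[mu]_(x in `[(- n.+1%:R : R)%R, (n.+1%:R : R)%R]) (f x)%:E)%E.
    rewrite [RHS]integral_mkcond; apply: eq_integral => x _.
    by rewrite /f_ /= !patchE; case: ifPn.
  have nn : - n.+1%:R < n.+1%:R :> R by rewrite gtrN.
  have cF x : {for x, continuous F}.
    by apply/differentiable_continuous/derivable1_diffP; have [] := dF x.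
  rewrite (continuous_FTC2 nn (F := F))//.
  - exact: continuous_subspaceT.
  - split => //.
    + exact/cvg_at_right_filter/cF.
    + exact/cvg_at_left_filter/cF.
  - by move=> x _; rewrite derive1E; have [_] := dF x.
move: cvgf; under eq_cvg do rewrite intE.
move=> /cvg_unique; apply=> //.
apply/cvg_EFin; first exact: nearW.
rewrite -(subrr 0); exact: cvgB.
Unshelve. all: by end_near. Qed.

Local Notation phi := (normal_pdf 0 1 : R -> R).

Lemma expR_ge_powfact (k : nat) (x : R) : 0 <= x -> x ^+ k <= k`!%:R * expR x.
Proof.
move=> x0; rewrite mulrC -ler_pdivrMr ?ltr0n ?fact_gt0//.
case: k => [|k]; first by rewrite expr0 fact0 divr1 (le_trans _ (expR_ge1Dx x))// lerDl.
by apply: le_trans (expR_ge1Dxn k x0); rewrite lerDr.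
Qed.

(** Comparing with a wider normal density, here of variance 2, gives both the
integrability of all moments and the decay at infinity. *)
Lemma gauss_tail_bound (k : nat) : exists C : R, forall y : R,
  `|y| ^+ k * phi y <= C * normal_pdf 0 (Num.sqrt 2) y.
Proof.
have s20 : Num.sqrt 2 != 0 :> R by rewrite gt_eqF// sqrtr_gt0.
(* t <= 1 + t^2 for t = |y|^k, and (y^2 / 4)^k <= k! exp (y^2 / 4) *)
pose K : R := 1 + 4 ^+ k * k`!%:R.
exists (K * normal_peak 1 / normal_peak (Num.sqrt 2)) => y.
rewrite !normal_pdfE ?oner_neq0//.
rewrite [leRHS]mulrA divfK ?gt_eqF ?normal_peak_gt0// mulrCA (mulrC K) -[leRHS]mulrA.
rewrite ler_pM2l ?normal_peak_gt0 ?oner_neq0// /normal_fun subr0.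
pose x := y ^+ 2 / 4.
have x0 : 0 <= x by rewrite divr_ge0// sqr_ge0.
rewrite expr1n sqr_sqrtr//.
have -> : - y ^+ 2 / (1 *+ 2) = - x + - x by rewrite /x; field.
have -> : - y ^+ 2 / (2 *+ 2) = - x by rewrite /x; field.
rewrite expRD mulrA ler_pM2r ?expR_gt0// expRN ler_pdivrMr ?expR_gt0//.
have yk : `|y| ^+ k <= 1 + 4 ^+ k * x ^+ k.
  rewrite -exprMn /x mulrCA divff// mulr1 -real_normK ?num_real// exprAC.
  by have := sqr_ge0 (`|y| ^+ k - 1); nra.
apply: (le_trans yk); rewrite /K mulrDl mul1r lerD//.
  by rewrite (le_trans _ (expR_ge1Dx x))// lerDl.
rewrite -mulrA ler_wpM2l ?exprn_ge0//.
exact: expR_ge_powfact.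
Qed.

Lemma gauss_decay (k : nat) : exists C : R, forall y : R, 0 < `|y| ->
  `|y ^+ k * phi y| <= C / `|y|.
Proof.
have [C HC] := gauss_tail_bound k.+1.
have s20 : Num.sqrt 2 != 0 :> R by rewrite gt_eqF// sqrtr_gt0.
exists (`|C| * normal_peak (Num.sqrt 2)) => y y0.
rewrite ler_pdivlMr// normrM normrX (ger0_norm (normal_pdf_ge0 _ _ _)).
rewrite mulrC mulrA -exprS (le_trans (HC y))//.
apply: (@le_trans _ _ (`|C| * normal_pdf 0 (Num.sqrt 2) y)).
  by rewrite ler_wpM2r ?normal_pdf_ge0 ?ler_norm.
by rewrite ler_wpM2l// normal_pdf_ub.
Qed.

Lemma integrable_gauss_density (k : nat) :
  mu.-integrable setT (EFin \o (fun y => y ^+ k * phi y)).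
Proof.
have [C HC] := gauss_tail_bound k.
apply: (@le_integrable _ (measurableTypeR R) _ mu _ measurableT _
   (fun y => (C%:E * (normal_pdf 0 (Num.sqrt 2) y)%:E)%E)) => //.
- apply/measurable_EFinP; apply: measurable_funM => //.
  exact: measurable_normal_pdf.
- move=> y _; rewrite -EFinM /= lee_fin (le_trans _ (ler_norm _))//.
  by rewrite normrM normrX (ger0_norm (normal_pdf_ge0 _ _ _)).
- by apply: integrableZl => //; exact: integrable_normal_pdf.
Qed.

Lemma gauss_integrable (k : nat) : gauss.-integrable setT (EFin \o (fun y => y ^+ k)).
Proof.
apply/integrableP; split; first exact/measurable_EFinP.
rewrite ge0_integral_normal_prob//; last first.
  by apply: measurableT_comp => //; exact/measurable_EFinP.
have /integrableP[_] := integrable_gauss_density k.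
congr (_ < _)%E; apply: eq_integral => y _ /=.
by rewrite normrM (ger0_norm (normal_pdf_ge0 _ _ _)) EFinM.
Qed.

Definition gauss_moment (k : nat) : R := (\int[gauss]_y y ^+ k)%R.

Lemma gauss_momentE k : gauss_moment k = (\int[mu]_y (y ^+ k * phi y))%R.
Proof. by congr fine; apply: integral_normal_prob. Qed.

End gauss_moments.

Section gauss_moments2.
Context (R : realType).
Local Notation mu := (@lebesgue_measure R).
Local Notation gauss := (normal_prob 0 1 : probability (measurableTypeR R) R).
Local Notation phi := (normal_pdf 0 1 : R -> R).

Lemma is_derive_gauss (y : R) : is_derive y (1 : R) phi (- y * phi y).
Proof.
have phiE : phi = (fun x => normal_peak 1 * expR (- (2^-1 * x ^+ 2))).
  apply/funext => x; rewrite normal_pdfE ?oner_neq0// /normal_fun subr0 expr1n.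
  by congr (_ * expR _); field.
rewrite phiE.
have h : is_derive y (1 : R) (fun x : R => - (2^-1 * x ^+ 2)) (- y).
  apply: is_derive_eq.
  rewrite /GRing.scale/=; by field.
apply: is_derive_eq.
rewrite /GRing.scale/=; ring.
Qed.

(** Integration by parts: the derivative of y^k phi (y) is
k y^(k-1) phi (y) - y^(k+1) phi (y), and it has integral 0.  At k = 0 the factor
k%:R cancels the meaningless predecessor. *)
Lemma gauss_moment_step (k : nat) :
  gauss_moment R k.+1 = k%:R * gauss_moment R k.-1.
Proof.
pose f (y : R) := k%:R * (y ^+ k.-1 * phi y) - y ^+ k.+1 * phi y.
pose F (y : R) := y ^+ k * phi y.
have ik := integrable_gauss_density R.
have iZ : mu.-integrable setT (EFin \o (fun y => k%:R * (y ^+ k.-1 * phi y))).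
  exact: (integrableZl measurableT k%:R (ik k.-1)).
have dF x : is_derive (x : R) (1 : R) F (f x).
  have dX := is_deriveX k (is_derive_id x (1 : R)).
  have := is_deriveM dX (is_derive_gauss x).
  have -> : id ^+ k * phi = F by apply/funext => y; rewrite /F !fctE.
  move=> dFx; apply: is_derive_eq.
  rewrite fctE /f /GRing.scale/= [x ^+ k.+1]exprS; ring.
have cphi : continuous phi by apply: continuous_normal_pdf; exact: oner_neq0.
have cX j : continuous (fun y : R => y ^+ j * phi y).
  by move=> x; apply: cvgM; [exact: exprn_continuous|exact: cphi].
have cf : continuous f.
  move=> x; apply: (@cvgB _ R^o); last exact: cX.
  by apply: cvgM; [exact: cvg_cst|exact: cX].
have [C HC] := gauss_decay R k.
have dec (u : nat -> R) : (forall n, `|u n| = n.+1%:R) -> F (u n) @[n --> \oo] --> (0 : R).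
  move=> uE; apply/norm_cvg0P.
  apply: (@squeeze_cvgr _ _ _ _ (cst 0) (fun n => C * n.+1%:R^-1)).
  - near=> n; rewrite normr_ge0/=.
    by rewrite (le_trans (HC _ _))// uE.
  - exact: cvg_cst.
  - rewrite -[X in _ --> X](mulr0 C); apply: cvgM; first exact: cvg_cst.
    exact: cvg_harmonic.
have := integral_derive_vanishing cf (integrableB measurableT iZ (ik k.+1)) dF.
have d1 : F n.+1%:R @[n --> \oo] --> (0 : R) by apply: dec => n; rewrite ger0_norm.
have d2 : F (- n.+1%:R) @[n --> \oo] --> (0 : R) by apply: dec => n; rewrite normrN ger0_norm.
move=> /(_ d1 d2) h.
rewrite !gauss_momentE -(@RintegralZl _ (measurableTypeR R) R mu setT _ k%:R measurableT (ik k.-1)).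
apply/esym/eqP; rewrite -subr_eq0 -(RintegralB measurableT iZ (ik k.+1)).
by rewrite /Rintegral h.
Unshelve. all: by end_near. Qed.

Lemma gauss_moment0 : gauss_moment R 0 = 1.
Proof.
rewrite /gauss_moment.
under eq_Rintegral do rewrite expr0.
by rewrite (Rintegral_cst gauss measurableT 1)/= probability_setT mulr1.
Qed.

Lemma gauss_moment1 : gauss_moment R 1 = 0.
Proof. by rewrite gauss_moment_step mul0r. Qed.

Lemma gauss_moment2 : gauss_moment R 2 = 1.
Proof. by rewrite gauss_moment_step gauss_moment0 mulr1. Qed.

Lemma gauss_moment3 : gauss_moment R 3 = 0.
Proof. by rewrite gauss_moment_step gauss_moment1 mulr0. Qed.

Lemma gauss_moment4 : gauss_moment R 4 = 3.
Proof. by rewrite gauss_moment_step gauss_moment2 mulr1. Qed.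

End gauss_moments2.

(** * Gaussian averages of Lipschitz functions *)

Section gauss_semigroup.
Context (R : realType).
Local Notation gauss := (normal_prob 0 1 : probability (measurableTypeR R) R).
Local Notation gauss_avg s := (mean_shift gauss (fun z : measurableTypeR R => s * z)).

Lemma gauss_integrableZ (s : R) : gauss.-integrable setT (EFin \o (fun z => s * z)).
Proof. exact: (integrableZl measurableT s (gauss_integrable R 1)). Qed.

Lemma lipschitz_funrpos (L : R) (f : R -> R) :
  lipschitz_with L f -> lipschitz_with L (fun x => Num.max (f x) 0).
Proof.
move=> fL x y; apply: le_trans (fL x y).
move: (f x) (f y) => a b; rewrite ler_norml.
have h1 := ler_norm (a - b); have h2 := ler_norm (b - a).
rewrite distrC in h2; have h3 := normr_ge0 (a - b).
by case: (lerP a 0) => ?; case: (lerP b 0) => ?; apply/andP; split; lra.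
Qed.

Lemma gauss_rotation_ge0 (L b x : R) (f : R -> R) : 0 <= b ->
  lipschitz_with L f -> (forall x, 0 <= f x) ->
  mean_shift gauss idfun (gauss_avg b f) x = gauss_avg (Num.sqrt (1 + b ^+ 2)) f x.
Proof.
rewrite le_eqVlt => /predU1P[<-|b0] fL f0.
  rewrite expr0n addr0 sqrtr1; apply: eq_Rintegral => y _; rewrite mul1r.
  transitivity (\int[gauss]_z f (x + y))%R.
    by apply: eq_Rintegral => z _; rewrite mul0r addr0.
  by rewrite (Rintegral_cst gauss measurableT)/= probability_setT mulr1.
have c0 : 0 < 1 + b ^+ 2 by rewrite ltr_wpDr ?sqr_ge0.
have cE : Num.sqrt (1 + b ^+ 2) ^+ 2 = 1 ^+ 2 + b ^+ 2.
  by rewrite sqr_sqrtr ?ltW// expr1n.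
have cG : continuous (fun u => f (x + u)).
  exact: lipschitz_continuous (lipschitz_shift x fL).
have := ge0_gauss_rotation b0 _ cE cG (fun u => f0 _).
rewrite sqrtr_gt0 => /(_ c0) h.
congr fine; rewrite -h; apply: eq_integral => y _.
rewrite /mean_shift /Rintegral fineK; last first.
  exact: (integrable_fin_num measurableT (mean_shift_integrable (gauss_integrableZ b) _ fL)).
by apply: eq_integral => z _; rewrite mul1r addrA.
Qed.

(** Both sides are additive in f, and the positive and negative parts of f stay
Lipschitz, so the nonnegative case suffices. *)
Lemma gauss_rotation (L b : R) (f : R -> R) : 0 <= b -> lipschitz_with L f ->
  mean_shift gauss idfun (gauss_avg b f) = gauss_avg (Num.sqrt (1 + b ^+ 2)) f.
Proof.
move=> b0 fL; apply/funext => x.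
pose fp x := Num.max (f x) 0; pose fn x := Num.max (- f x) 0.
have fpL : lipschitz_with L fp by exact: lipschitz_funrpos.
have fnL : lipschitz_with L fn.
  by apply: lipschitz_funrpos => u v; rewrite -opprD normrN.
have fE y : f y = fp y - fn y.
  by rewrite /fp /fn; case: (lerP (f y) 0) => ?; case: (lerP (- f y) 0) => ?; lra.
have subE s y : gauss_avg s f y = gauss_avg s fp y - gauss_avg s fn y.
  rewrite /mean_shift -RintegralB//; last 2 first.
  - exact: (mean_shift_integrable (gauss_integrableZ s) y fpL).
  - exact: (mean_shift_integrable (gauss_integrableZ s) y fnL).
  by apply: eq_Rintegral => z _; exact: fE.
have iid : gauss.-integrable setT (EFin \o idfun) by exact: gauss_integrable R 1.
rewrite subE -(gauss_rotation_ge0 x b0 fpL) -?(gauss_rotation_ge0 x b0 fnL); last 2 first.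
- by move=> y; rewrite le_max lexx orbT.
- by move=> y; rewrite le_max lexx orbT.
rewrite {1 3 5}/mean_shift -RintegralB//; last 2 first.
- exact: (mean_shift_integrable iid _ (lipschitz_mean_shift (gauss_integrableZ b) fpL)).
- exact: (mean_shift_integrable iid _ (lipschitz_mean_shift (gauss_integrableZ b) fnL)).
by apply: eq_Rintegral => z _; exact: subE.
Qed.

Lemma iter_gauss_avg (k : nat) (L : R) (f : R -> R) : lipschitz_with L f ->
  iter k (mean_shift gauss idfun) f = gauss_avg (Num.sqrt k%:R) f.
Proof.
move=> fL; elim: k => [|k IH] /=.
  apply/funext => x; rewrite sqrtr0; transitivity (\int[gauss]_z f x)%R.
    by rewrite (Rintegral_cst gauss measurableT)/= probability_setT mulr1.
  by apply: eq_Rintegral => z _; rewrite mul0r addr0.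
by rewrite IH (gauss_rotation _ fL) ?sqrtr_ge0// sqr_sqrtr// -natr1 addrC.
Qed.

End gauss_semigroup.

(** * Taylor expansion and a single exchange *)

Section taylor.
Context (R : realType).

(** The monomial bound minus (or plus) g has a nonnegative derivative on [0, y].
Iterating this lemma down the derivatives gives Taylor's inequality without
any continuity of the last derivative. *)
Lemma derive_monomial_bound (k : nat) (C y : R) (g dg : R -> R) :
  0 <= y -> (forall t : R, is_derive t (1 : R) g (dg t)) -> g 0 = 0 ->
  (forall t, 0 <= t -> `|dg t| <= C * (t ^+ k / k`!%:R)) ->
  `|g y| <= C * (y ^+ k.+1 / k.+1`!%:R).
Proof.
move=> y0 dgP g0 dgb.
have mono (s : R) : `|s| = 1 -> s * g y <= C * (y ^+ k.+1 / k.+1`!%:R).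
  move=> s1.
  pose p (t : R) := C * (t ^+ k.+1 / k.+1`!%:R) - s * g t.
  have dp t : is_derive (t : R) (1 : R) p (C * (t ^+ k / k`!%:R) - s * dg t).
    have dX := is_deriveX k.+1 (is_derive_id t (1 : R)).
    have := is_deriveB (is_deriveZ (C / k.+1`!%:R) dX) (is_deriveZ s (dgP t)).
    rewrite (_ : _ - _ = p); last first.
      apply/funext => u; rewrite /p !fctE /GRing.scale/=. 
      by congr (_ - _); rewrite [LHS]mulrAC -mulrA.
    move=> h; apply: is_derive_eq.
    rewrite /GRing.scale/= mulr1 factS natrM; congr (_ - _).
    have k0 : k`!%:R != 0 :> R by rewrite pnatr_eq0 -lt0n fact_gt0.
    have k1 : k.+1%:R != 0 :> R by rewrite pnatr_eq0.
    by move: (k`!%:R) (k.+1%:R) k0 k1 => u v u0 v0; field; rewrite u0 v0.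
  have cp t : {for t, continuous p}.
    by apply/differentiable_continuous/derivable1_diffP; have [] := dp t.
  have p0y : p 0 <= p y.
    apply: (@ger0_derive1_le_cc R p 0 y) => //.
    - move=> t; rewrite in_itv/= => /andP[t0 _].
      rewrite derive1E; have [_ ->] := dp t.
      rewrite subr_ge0; apply: le_trans (dgb t (ltW t0)).
      by rewrite (le_trans (ler_norm _))// normrM s1 mul1r.
    - exact: continuous_subspaceT.
    - by rewrite in_itv/= lexx.
    - by rewrite in_itv/= lexx andbT.
  by move: p0y; rewrite /p g0 expr0n /= mul0r !mulr0 subrr subr_ge0.
rewrite ler_norml; apply/andP; split.
  by rewrite lerNl -mulN1r; apply: mono; rewrite normrN1.
by rewrite -[leLHS]mul1r; apply: mono; rewrite normr1.
Qed.

Lemma taylor4_ge0 (h h1 h2 h3 h4 : R -> R) (M x y : R) : 0 <= y ->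
  (forall t : R, is_derive t (1 : R) h (h1 t)) ->
  (forall t : R, is_derive t (1 : R) h1 (h2 t)) ->
  (forall t : R, is_derive t (1 : R) h2 (h3 t)) ->
  (forall t : R, is_derive t (1 : R) h3 (h4 t)) ->
  (forall t, `|h4 t| <= M) ->
  `|h (x + y) - (h x + h1 x * y + h2 x * (y ^+ 2 / 2) + h3 x * (y ^+ 3 / 6))|
    <= M * (y ^+ 4 / 24).
Proof.
move=> y0 dh dh1 dh2 dh3 h4M.
have dshift (f df : R -> R) t : (forall t : R, is_derive t (1 : R) f (df t)) ->
    is_derive (t : R) (1 : R) (fun t => f (x + t)) (df (x + t)).
  move=> df'.
  have dxt : is_derive t (1 : R) (fun t : R => x + t) 1.
    by apply: is_derive_eq; rewrite add0r mulr1.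
  have := @is_derive1_comp R f (fun t => x + t) t _ _ (df' _) dxt.
  by rewrite mulr1.
have poly (n : nat) t : is_derive (t : R) (1 : R) (fun t => t ^+ n) (n%:R * t ^+ n.-1).
  have := is_deriveX n (is_derive_id t (1 : R)).
  rewrite (_ : id ^+ n = (fun t => t ^+ n)); last by apply/funext => u; rewrite fctE.
  by rewrite /GRing.scale/= mulr1.
pose g3 t := h3 (x + t) - h3 x.
pose g2 t := h2 (x + t) - (h2 x + h3 x * t).
pose g1 t := h1 (x + t) - (h1 x + h2 x * t + h3 x * (t ^+ 2 / 2)).
pose g0 t := h (x + t) - (h x + h1 x * t + h2 x * (t ^+ 2 / 2) + h3 x * (t ^+ 3 / 6)).
have b3 t : 0 <= t -> `|g3 t| <= M * (t ^+ 1 / 1`!%:R).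
  move=> t0; apply: (derive_monomial_bound (dg := fun t => h4 (x + t))) => //.
  - move=> u; have du := dshift _ _ u dh3; rewrite /g3.
    apply: is_derive_eq; rewrite /GRing.scale/=; ring.
  - by rewrite /g3 addr0 subrr.
  - by move=> u _; rewrite expr0 fact0 divr1 mulr1.
have b2 t : 0 <= t -> `|g2 t| <= M * (t ^+ 2 / 2`!%:R).
  move=> t0; apply: (derive_monomial_bound (dg := g3)) => //.
  - move=> u; have du := dshift _ _ u dh2; rewrite /g2.
    apply: is_derive_eq; rewrite /g3 /GRing.scale/=; ring.
  - by rewrite /g2 !addr0 mulr0 addr0 subrr.
have b1 t : 0 <= t -> `|g1 t| <= M * (t ^+ 3 / 3`!%:R).
  move=> t0; apply: (derive_monomial_bound (dg := g2)) => //.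
  - move=> u; have du := dshift _ _ u dh1; have d2 := poly 2%N u; rewrite /g1.
    by apply: is_derive_eq; rewrite /g2 /GRing.scale/=; field.
  - by rewrite /g1 !addr0 expr0n /= !(mul0r, mulr0, addr0) subrr.
apply: (derive_monomial_bound (g := g0) (dg := g1)) => //.
- move=> u; have du := dshift _ _ u dh; rewrite /g0.
  have d2 := poly 2%N u; have d3 := poly 3%N u.
  by apply: is_derive_eq; rewrite /g1 /GRing.scale/=; field.
- by rewrite /g0 !addr0 !expr0n /= !(mul0r, mulr0, addr0) subrr.
Qed.

End taylor.

Section one_step.
Context (R : realType).
Variables (h h1 h2 h3 h4 : R -> R) (M : R).
Hypothesis dh : forall t : R, is_derive t (1 : R) h (h1 t).
Hypothesis dh1 : forall t : R, is_derive t (1 : R) h1 (h2 t).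
Hypothesis dh2 : forall t : R, is_derive t (1 : R) h2 (h3 t).
Hypothesis dh3 : forall t : R, is_derive t (1 : R) h3 (h4 t).
Hypothesis h4M : forall t, `|h4 t| <= M.

Lemma taylor4 (x y : R) :
  `|h (x + y) - (h x + h1 x * y + h2 x * (y ^+ 2 / 2) + h3 x * (y ^+ 3 / 6))|
    <= M * (y ^+ 4 / 24).
Proof.
have [y0|y0] := leP 0 y; first exact: (taylor4_ge0 x y0 dh dh1 dh2 dh3 h4M).
have flip (f df : R -> R) t : (forall t : R, is_derive t (1 : R) f (df t)) ->
    is_derive (t : R) (1 : R) (fun t => f (- t)) (- df (- t)).
  move=> df'.
  have := @is_derive1_comp R f (fun t => - t) t _ _ (df' _) (is_deriveNid t (1 : R)).
  by rewrite mulrN1.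
have flipN (f df : R -> R) t : (forall t : R, is_derive t (1 : R) f (df t)) ->
    is_derive (t : R) (1 : R) (fun t => - f (- t)) (df (- t)).
  move=> df'; have := is_deriveN (flip f df t df').
  by rewrite opprK.
have Ny0 : 0 <= - y by rewrite oppr_ge0 ltW.
have := taylor4_ge0 (- x) Ny0 (fun t => flip _ _ t dh) (fun t => flipN _ _ t dh1)
  (fun t => flip _ _ t dh2) (fun t => flipN _ _ t dh3) (fun t => h4M (- t)).
have e3 : (- y) ^+ 3 / 6 = - (y ^+ 3 / 6) by field.
have e4 : (- y) ^+ 4 = y ^+ 4 by ring.
by rewrite -opprD !opprK sqrrN e3 e4 !mulrNN.
Qed.

Context d (T : measurableType d) (P : probability T R).

Lemma Rintegral_cubic_standardized (U : T -> R) (c0 c1 c2 c3 : R) :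
  (forall k, (k <= 3)%N -> P.-integrable setT (EFin \o (fun t => U t ^+ k))) ->
  (\int[P]_t U t)%R = 0 -> (\int[P]_t U t ^+ 2)%R = 1 -> (\int[P]_t U t ^+ 3)%R = 0 ->
  P.-integrable setT (EFin \o (fun t => c0 + c1 * U t + c2 * U t ^+ 2 + c3 * U t ^+ 3)) /\
  (\int[P]_t (c0 + c1 * U t + c2 * U t ^+ 2 + c3 * U t ^+ 3))%R = c0 + c2.
Proof.
move=> iU m1 m2 m3.
have i0 : P.-integrable setT (EFin \o (fun=> c0)) by exact: finite_measure_integrable_cst.
have i1 : P.-integrable setT (EFin \o (fun t => c1 * U t)).
  exact: (integrableZl measurableT c1 (iU 1%N isT)).
have i2 : P.-integrable setT (EFin \o (fun t => c2 * U t ^+ 2)).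
  exact: (integrableZl measurableT c2 (iU 2%N isT)).
have i3 : P.-integrable setT (EFin \o (fun t => c3 * U t ^+ 3)).
  exact: (integrableZl measurableT c3 (iU 3%N isT)).
have i01 : P.-integrable setT (EFin \o (fun t => c0 + c1 * U t)).
  exact: (integrableD measurableT i0 i1).
have i012 : P.-integrable setT (EFin \o (fun t => c0 + c1 * U t + c2 * U t ^+ 2)).
  exact: (integrableD measurableT i01 i2).
split; first exact: (integrableD measurableT i012 i3).
rewrite (RintegralD measurableT i012 i3) (RintegralD measurableT i01 i2).
rewrite (RintegralD measurableT i0 i1) (Rintegral_cst P measurableT)/= probability_setT mulr1.
rewrite (@RintegralZl _ T R P setT _ c1 measurableT (iU 1%N isT)).
rewrite (@RintegralZl _ T R P setT _ c2 measurableT (iU 2%N isT)).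
rewrite (@RintegralZl _ T R P setT _ c3 measurableT (iU 3%N isT)).
by rewrite m1 m2 m3 !mulr0 mulr1 !addr0.
Qed.

(** The right-hand approximation depends on the law of U only through its first
three moments, so it is the same for X and for Z. *)
Lemma mean_shift_second_order (U : T -> R) (L s x : R) :
  lipschitz_with L (fun y => h (s * y)) ->
  (forall k, (k <= 4)%N -> P.-integrable setT (EFin \o (fun t => U t ^+ k))) ->
  (\int[P]_t U t)%R = 0 -> (\int[P]_t U t ^+ 2)%R = 1 -> (\int[P]_t U t ^+ 3)%R = 0 ->
  `|mean_shift P U (fun y => h (s * y)) x - (h (s * x) + h2 (s * x) * (s ^+ 2 / 2))|
    <= M * s ^+ 4 / 24 * (\int[P]_t U t ^+ 4)%R.
Proof.
move=> gL iU m1 m2 m3.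
have [ip Ep] := @Rintegral_cubic_standardized U (h (s * x)) (h1 (s * x) * s)
  (h2 (s * x) * (s ^+ 2 / 2)) (h3 (s * x) * (s ^+ 3 / 6))
  (fun k k3 => iU k (leqW k3)) m1 m2 m3.
have ig := mean_shift_integrable (iU 1%N isT) x gL.
rewrite -Ep /mean_shift -(RintegralB measurableT ig ip).
have i4 := iU 4%N isT.
have iB := integrableB measurableT ig ip.
rewrite -(@RintegralZl _ T R P setT _ (M * s ^+ 4 / 24) measurableT i4).
apply: (le_trans (le_normr_Rintegral measurableT iB)).
apply: le_Rintegral => //.
- exact: (integrable_norm iB).
- exact: (integrableZl measurableT (M * s ^+ 4 / 24) i4).
move=> t _; have := taylor4 (s * x) (s * U t).
rewrite -mulrDr !exprMn.
rewrite (_ : M * (s ^+ 4 * U t ^+ 4 / 24) = M * s ^+ 4 / 24 * U t ^+ 4); last by field.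
apply: le_trans; rewrite le_eqVlt; apply/orP; left; apply/eqP.
by congr (`| _ - _ |); field.
Qed.

End one_step.

(** * The normal approximation *)

Lemma bounded_fun_bound (R : realType) (f : R -> R) :
  [bounded f x | x in [set: R]] -> exists C, forall x, `|f x| <= C.
Proof.
move=> fb; have PF : ProperFilter (globally [set: R]) by exact: (@globally_properfilter _ _ 0).
by have /ex_bound[C CP] := fb; exists C => x; exact: CP.
Qed.

Lemma bounded_derive_lipschitz (R : realType) (f df : R -> R) (C : R) :
  (forall t : R, is_derive t (1 : R) f (df t)) -> (forall t, `|df t| <= C) ->
  lipschitz_with C f.
Proof.
move=> fdf dfC.
have cf t : {for t, continuous f}.
  by apply/differentiable_continuous/derivable1_diffP; have [] := fdf t.
have lt_case x y : x <= y -> `|f x - f y| <= C * `|x - y|.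
  move=> xy; have [c _ fE] := MVT_segment xy (fun t _ => fdf t) (continuous_subspaceT cf).
  by rewrite distrC fE normrM (distrC x) ler_wpM2r.
move=> x y; have [xy|/ltW yx] := leP x y; first exact: lt_case.
by rewrite distrC (distrC x); exact: lt_case.
Qed.

Lemma lipschitz_scale (R : realType) (L s : R) (f : R -> R) :
  lipschitz_with L f -> lipschitz_with (L * `|s|) (fun x => f (s * x)).
Proof. by move=> fL x y; rewrite (le_trans (fL _ _))// -mulrBr normrM mulrA. Qed.

Lemma integrable_pow_le4 d (T : measurableType d) (R : realType)
    (P : probability T R) (U : T -> R) (k : nat) :
  measurable_fun setT U -> P.-integrable setT (EFin \o (fun t => U t ^+ 4)) ->
  (k <= 4)%N -> P.-integrable setT (EFin \o (fun t => U t ^+ k)).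
Proof.
move=> mU i4 k4.
apply: (@le_integrable _ _ _ P _ measurableT _ (fun t => (1 + U t ^+ 4)%:E)).
- by apply/measurable_EFinP; exact: measurable_funX.
- move=> t _; rewrite /= lee_fin normrX.
  have e4 : U t ^+ 4 = `|U t| ^+ 4 by rewrite -[LHS]ger0_norm ?normrX// exprn_even_ge0.
  rewrite e4 [leRHS]ger0_norm ?addr_ge0 ?exprn_ge0//.
  have [u1|/ltW u1] := leP `|U t| 1.
    by rewrite (le_trans (exprn_ile1 _ _ _))// lerDl exprn_ge0.
  by rewrite (le_trans (ler_weXn2l u1 k4))// lerDr.
- have i1 : P.-integrable setT (fun=> 1%:E) by exact: finite_measure_integrable_cst.
  exact: (integrableD measurableT i1 i4).
Qed.

Section clt_bound.
Context (R : realType) d (T : measurableType d) (P : probability T R).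
Local Notation gauss := (normal_prob 0 1 : probability (measurableTypeR R) R).
Variables (h h1 h2 h3 h4 : R -> R) (L M : R).
Hypothesis dh : forall t : R, is_derive t (1 : R) h (h1 t).
Hypothesis dh1 : forall t : R, is_derive t (1 : R) h1 (h2 t).
Hypothesis dh2 : forall t : R, is_derive t (1 : R) h2 (h3 t).
Hypothesis dh3 : forall t : R, is_derive t (1 : R) h3 (h4 t).
Hypothesis h1L : forall t, `|h1 t| <= L.
Hypothesis h4M : forall t, `|h4 t| <= M.
Variable U : T -> R.
Hypothesis iU : forall k, (k <= 4)%N -> P.-integrable setT (EFin \o (fun t => U t ^+ k)).
Hypothesis m1 : (\int[P]_t U t)%R = 0.
Hypothesis m2 : (\int[P]_t U t ^+ 2)%R = 1.
Hypothesis m3 : (\int[P]_t U t ^+ 3)%R = 0.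

(** One exchange costs at most |h^(4)| (E U^4 + 3) / (24 n^2), because the second
order approximation of [mean_shift_second_order] is common to U and to the
standard normal variable. *)
Lemma lindeberg_gauss (n : nat) : (0 < n)%N ->
  `|iter n (mean_shift P U) (fun x => h ((Num.sqrt n%:R)^-1 * x)) 0 - (\int[gauss]_z h z)%R| <=
    n%:R^-1 * (M / 24 * ((\int[P]_t U t ^+ 4)%R + 3)).
Proof.
move=> n0; set s := (Num.sqrt n%:R)^-1.
pose g := fun x => h (s * x); rewrite -/g.
have sn0 : Num.sqrt n%:R != 0 :> R by rewrite gt_eqF// sqrtr_gt0 ltr0n.
have hL : lipschitz_with L h by exact: bounded_derive_lipschitz dh h1L.
have gL := lipschitz_scale s hL; rewrite -/g in gL.
have iG k : (k <= 4)%N -> gauss.-integrable setT (EFin \o (fun t => idfun t ^+ k)).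
  by move=> _; exact: gauss_integrable.
pose C := M * s ^+ 4 / 24 * ((\int[P]_t U t ^+ 4)%R + 3).
have close x : `|mean_shift P U g x - mean_shift gauss idfun g x| <= C.
  have bU := mean_shift_second_order dh dh1 dh2 dh3 h4M x gL iU m1 m2 m3.
  have bG := mean_shift_second_order dh dh1 dh2 dh3 h4M x gL iG
    (gauss_moment1 R) (gauss_moment2 R) (gauss_moment3 R).
  rewrite [(\int[_]_t _)%R](gauss_moment4 R) in bG.
  rewrite -/g in bU bG.
  apply: (le_trans (ler_distD _ _ _)); rewrite /C mulrDr lerD//; first exact: bU.
  by rewrite distrC; exact: bG.
have iU1 : P.-integrable setT (EFin \o U) by exact: (iU (k := 1) isT).
have iG1 : gauss.-integrable setT (EFin \o idfun) by exact: (iG 1%N isT).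
have := iter_mean_shift_swap iU1 iG1 n gL close 0.
rewrite (iter_gauss_avg n gL).
rewrite [X in `|_ - X|](_ : _ = (\int[gauss]_z h z)%R); last first.
  by apply: eq_Rintegral => z _; rewrite /g add0r mulrA mulVf// mul1r.
move=> /le_trans->//; rewrite le_eqVlt; apply/orP; left; apply/eqP.
(* the gain: n steps of size n^-2 each *)
have s4 : s ^+ 4 = n%:R^-1 ^+ 2.
  by rewrite /s (exprM _ 2 2) exprVn sqr_sqrtr.
rewrite /C s4; have : n%:R != 0 :> R by rewrite pnatr_eq0 -lt0n.
by move: (n%:R) => v v0; field.
Qed.

End clt_bound.

Lemma sup_norm_finite (R : realType) (f : R -> R) :
  [bounded f x | x in [set: R]] ->
  exists2 M, sup_norm f = M%:E & forall x, `|f x| <= M.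
Proof.
move=> /bounded_fun_bound[C fC].
have ub x : ((`|f x|)%:E <= sup_norm f)%E by apply: ereal_sup_ubound; exists x.
have lb : (sup_norm f <= C%:E)%E by apply: ge_ereal_sup => _ [x _ <-]; rewrite lee_fin.
have fin : sup_norm f \is a fin_num.
  rewrite fin_real// (lt_le_trans _ (ub 0)) ?ltNyr//.
  by rewrite (le_lt_trans lb)// ltry.
exists (fine (sup_norm f)); first by rewrite fineK.
by move=> x; rewrite -lee_fin fineK.
Qed.

Lemma is_derive_derive1n (R : realType) (m k : nat) (h : R -> R) (x : R) :
  has_bounded_derivatives m h -> (k < m)%N ->
  is_derive x (1 : R) (h^`(k))%classic ((h^`(k.+1))%classic x).
Proof.
by move=> [hd _] km; rewrite derive1nS derive1E; exact/derivableP/hd.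
Qed.

Lemma identically_distributed_integrable d (T : measurableType d) (R : realType)
    (P : probability T R) (I : finType) (X : I -> {RV P >-> R}) (i j : I) :
  identically_distributed X -> P.-integrable setT (EFin \o X i) ->
  P.-integrable setT (EFin \o X j).
Proof.
move=> idX /integrableP[_ Xi]; apply/integrableP; split; first exact/measurable_EFinP.
have mabs : measurable_fun setT (fun y : R => `|y%:E|%E).
  by apply: measurableT_comp => //; exact/measurable_EFinP.
rewrite -[ltLHS](ge0_integral_distribution (X j) mabs)//.
rewrite (eq_measure_integral (distribution P (X i))).
  by rewrite ge0_integral_distribution.
by move=> A mA _; exact: idX.
Qed.

Theorem corollary3p1 (d : measure_display) (T : measurableType d)
    (R : realType) (P : probability T R) (n : nat)
    (X : {RV P >-> R}) (Xs : 'I_n -> {RV P >-> R}) (h : R -> R)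
    (n_gt0 : (0 < n)%N)
    (X_iid : iid (fun o : option 'I_n => if o is Some i then Xs i else X))
    (X_mean : ('E_P[X] = 0)%E)
    (X_var : ('V_P[X] = 1)%E)
    (X_third : ('E_P[fun t => (X t ^+ 3)%R] = 0)%E)
    (X_fourth : ('E_P[fun t => (X t ^+ 4)%R] < +oo)%E)
    (h_deriv : has_bounded_derivatives 4 h) :
  let W := fun t : T => \sum_(i < n) Xs i t in
  (`| 'E_P[fun t => (h (W t / Num.sqrt n%:R) - fine (Phi h))%R] | <=
   (n%:R^-1)%:E * ((1 / 3)%:E * sup_norm (h^`(3))%classic +
                   (1 / 6)%:E * sup_norm (h^`(4))%classic *
                     'E_P[fun t => (X t ^+ 4)%R]))%E.
Proof.
cbv zeta; set W := fun t : T => \sum_(i < n) Xs i t.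
have [X_ind X_id] := X_iid.
set Y := fun o : option 'I_n => _ in X_iid X_ind X_id.
have mX : measurable_fun setT X by [].
have i4 : P.-integrable setT (EFin \o (fun t => X t ^+ 4)).
  apply/integrableP; split; first by apply/measurable_EFinP; exact: measurable_funX.
  move: X_fourth; rewrite unlock; congr (_ < _)%E; apply: eq_integral => t _ /=.
  by rewrite ger0_norm// exprn_even_ge0.
have iX k : (k <= 4)%N -> P.-integrable setT (EFin \o (fun t => X t ^+ k)).
  exact: integrable_pow_le4.
have m1 : (\int[P]_t X t)%R = 0.
  by move: X_mean; rewrite unlock /Rintegral => ->.
have m2 : (\int[P]_t X t ^+ 2)%R = 1.
  have V : ('V_P[X] = \int[P]_t (X t ^+ 2)%:E)%E.
    rewrite /variance covariance.unlock X_mean /= expectation.unlock.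
    by apply: eq_integral => t _; rewrite fctE /= subr0 expr2.
  by rewrite /Rintegral -V X_var.
have m3 : (\int[P]_t X t ^+ 3)%R = 0.
  by move: X_third; rewrite unlock /Rintegral => ->.
set m4 := (\int[P]_t X t ^+ 4)%R.
have m4E : ('E_P[fun t => (X t ^+ 4)%R] = m4%:E)%E.
  by rewrite unlock /m4 /Rintegral fineK//; exact: (integrable_fin_num measurableT i4).
have m4_ge1 : 1 <= m4.
  have i2 := iX 2%N isT; have i0 : P.-integrable setT (EFin \o (fun=> 1 : R)).
    exact: finite_measure_integrable_cst.
  have i2' : P.-integrable setT (EFin \o (fun t => 2 * X t ^+ 2)).
    exact: (integrableZl measurableT 2 i2).
  have i20 := integrableB measurableT i2' i0.
  (* 2 x^2 - 1 <= x^4 pointwise *)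
  have := le_Rintegral measurableT i20 i4.
  rewrite (RintegralB measurableT i2' i0) (Rintegral_cst P measurableT)/= probability_setT.
  rewrite (@RintegralZl _ T R P setT _ 2 measurableT i2) m2 -/m4 => H.
  have {}H : 2 * 1 - 1 * 1 <= m4.
    by apply: H => t _; have := sqr_ge0 (X t ^+ 2 - 1); nra.
  by lra.
have D k x : (k < 4)%N -> is_derive x (1 : R) (h^`(k))%classic ((h^`(k.+1))%classic x).
  exact: is_derive_derive1n.
have [C1 h1C] := bounded_fun_bound (h_deriv.2 1%N isT).
have [N3 N3E h3N] := sup_norm_finite (h_deriv.2 3%N isT).
have [M ME h4M] := sup_norm_finite (h_deriv.2 4%N isT).
have M0 : 0 <= M by exact: le_trans (normr_ge0 _) (h4M 0).
have N30 : 0 <= N3 by exact: le_trans (normr_ge0 _) (h3N 0).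
have bound := lindeberg_gauss (fun t => D 0%N t isT) (fun t => D 1%N t isT)
  (fun t => D 2%N t isT) (fun t => D 3%N t isT) h1C h4M iX m1 m2 m3 n_gt0.
rewrite derive1n0 in bound.
have hL : lipschitz_with C1 h.
  by apply: (bounded_derive_lipschitz (df := (h^`(1))%classic)) => // t; exact: (D 0%N t isT).
have gL := lipschitz_scale (Num.sqrt n%:R)^-1 hL.
(* the index None stands for X itself *)
pose J : {set option 'I_n} := [set Some i | i in [set: 'I_n]]%SET.
have Jn : #|J| = n by rewrite card_imset ?cardsT ?card_ord//; exact: Some_inj.
have iY o : P.-integrable setT (EFin \o Y o).
  exact: (identically_distributed_integrable (i := None) o X_id (iX 1%N isT)).
have WE t : block_sum Y J t = W t.
  rewrite block_sumE big_imset/=; last by move=> i j _ _ [].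
  by apply: eq_bigl => i; rewrite inE.
have EW := expectation_block_sum X_ind X_id iY None J gL.
rewrite Jn in EW.
have iW : P.-integrable setT (EFin \o W).
  by have := block_sum_integrable iY J; apply: eq_integrable => // t _ /=; rewrite WE.
have ihW : P.-integrable setT (EFin \o (fun t => h (W t / Num.sqrt n%:R))).
  have mW : measurable_fun setT W by apply/measurable_EFinP; exact: measurable_int iW.
  have := lipschitz_integrable gL mW iW.
  by apply: eq_integrable => // t _ /=; rewrite mulrC.
have EE : ('E_P[fun t => (h (W t / Num.sqrt n%:R) - fine (Phi h))%R] =
   (iter n (mean_shift P X) (fun x => h ((Num.sqrt n%:R)^-1 * x)) 0 - (\int[normal_prob 0 1]_z h z)%R)%:E)%E.
  have icst : P.-integrable setT (EFin \o (fun=> fine (Phi h))).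
    exact: finite_measure_integrable_cst.
  have iB := integrableB measurableT ihW icst.
  rewrite expectation.unlock -[LHS](fineK (integrable_fin_num measurableT iB)).
  congr EFin; rewrite -[LHS]/(Rintegral _ _ _) (RintegralB measurableT ihW icst).
  rewrite (Rintegral_cst P measurableT)/= probability_setT mulr1 -EW; congr (_ - _).
    by apply: eq_Rintegral => t _; rewrite WE mulrC.
  by rewrite /Phi expectation.unlock.
rewrite EE.
have finish (S3 S4 E4 : \bar R) (e : R) : S3 = N3%:E -> S4 = M%:E -> E4 = m4%:E ->
    `|e| <= n%:R^-1 * (M / 24 * (m4 + 3)) ->
    (`|e%:E| <= n%:R^-1%:E * ((1 / 3)%:E * S3 + (1 / 6)%:E * S4 * E4))%E.
  move=> -> -> -> eM; rewrite abse_EFin -[leRHS]/((n%:R^-1 * (1 / 3 * N3 + 1 / 6 * M * m4))%:E) lee_fin.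
  apply: (le_trans eM); rewrite ler_pM2l ?invr_gt0 ?ltr0n//.
  (* discards the term in the third derivative and uses 1 <= m4 *)
  by nra.
exact: (finish _ _ _ _ N3E ME m4E bound).
Qed.
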